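(* For any graph $G$ of order $n$, $$\gamma_{\rm sp}(G)\le n-\rho(L(G)).$$
   Context: All graphs are finite, simple and undirected. For a vertex $v$ of a graph $G$, $N(v)$ denotes the set of vertices adjacent to $v$ and $N[v]=N(v)\cup\{v\}$. For $D\subseteq V(G)$ write $\overline{D}=V(G)\setminus D$. A set $D\subseteq V(G)$ is a super dominating set of $G$ if for every $u\in\overline{D}$ there exists $v\in D$ such that $N(v)\cap\overline{D}=\{u\}$; the super domination number $\gamma_{\rm sp}(G)$ is the minimum cardinality of a super dominating set of $G$. The line graph $L(G)$ has the edges of $G$ as vertices, two being adjacent iff the corresponding edges of $G$ share an endpoint. A set $X$ of vertices of a graph $F$ is a $2$-packing if $N[u]\cap N[v]=\emptyset$ for all distinct $u,v\in X$; the $2$-packing number $\rho(F)$ is the maximum cardinality of a $2$-packing of $F$. *)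

(* Defs.v *)
From mathcomp Require Import all_boot.

Set Implicit Arguments.
Unset Strict Implicit.
Unset Printing Implicit Defensive.

Record sgraph := SGraph {
  vertex :> finType;
  adj : rel vertex;
  adj_sym : symmetric adj;
  adj_irr : irreflexive adj
}.

Definition nbh (G : sgraph) (v : G) : {set G} := [set u | adj v u].

Definition closed_nbh (G : sgraph) (v : G) : {set G} := v |: nbh v.

Definition super_dominating (G : sgraph) (D : {set G}) : bool :=
  [forall u in ~: D, exists v in D, nbh v :&: ~: D == [set u]].

(* [arg min] needs a witness that the minimised family is nonempty; the whole
   vertex set is one, by [super_dominatingT]. *)
Definition super_domination_number (G : sgraph) : nat :=
  #|[arg min_(D < [set: G] | super_dominating D) #|D|]|.

Lemma super_dominatingT (G : sgraph) : super_dominating [set: G].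
Proof. by apply/forall_inP => u; rewrite setCT inE. Qed.

Lemma super_domination_number_min (G : sgraph) :
  (exists2 D : {set G}, super_dominating D & #|D| = super_domination_number G)
  /\ forall D : {set G}, super_dominating D -> super_domination_number G <= #|D|.
Proof.
rewrite /super_domination_number.
by case: arg_minnP => [|D sD minD]; [exact: super_dominatingT | split; first exists D].
Qed.

Definition edges (G : sgraph) : {set {set G}} :=
  [set [set p.1; p.2] | p : G * G & adj p.1 p.2].

Definition edge (G : sgraph) : finType := {A : {set G} | A \in edges G}.

Definition line_adj (G : sgraph) : rel (edge G) :=
  fun A B => (A != B) && (val A :&: val B != set0).

Lemma line_adj_sym (G : sgraph) : symmetric (@line_adj G).
Proof. by move=> A B; rewrite /line_adj eq_sym setIC. Qed.

Lemma line_adj_irr (G : sgraph) : irreflexive (@line_adj G).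
Proof. by move=> A; rewrite /line_adj eqxx. Qed.

Definition line_graph (G : sgraph) : sgraph :=
  SGraph (@line_adj_sym G) (@line_adj_irr G).

Definition two_packing (F : sgraph) (X : {set F}) : bool :=
  [forall u in X, forall v in X,
    (u != v) ==> [disjoint closed_nbh u & closed_nbh v]].

Definition packing_number (F : sgraph) : nat :=
  \max_(X : {set F} | two_packing X) #|X|.

(* Main.v *)
(* Two edges have disjoint closed neighbourhoods in L(G) exactly when they share
   no endpoint and no edge of G joins them, so a 2-packing of L(G) is an induced
   matching. Deleting one endpoint of each of its edges from V(G) leaves a super
   dominating set: the other endpoint sees no other deleted vertex. *)

Require Import Defs.
From mathcomp Require Import all_boot all_order all_algebra.

Set Implicit Arguments.
Unset Strict Implicit.
Unset Printing Implicit Defensive.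

Lemma edge_endpoints (G : sgraph) (A : edge G) :
  exists p : G * G, adj p.1 p.2 && (val A == [set p.1; p.2]).
Proof.
have /imsetP[p] := valP A; rewrite inE => adjp defA.
by exists p; rewrite adjp; apply/eqP.
Qed.

(** An arbitrary orientation of each edge: the first endpoint is the one to be deleted, the second
    is kept as its dominator. *)
Definition endpoints (G : sgraph) (A : edge G) : G * G :=
  xchoose (edge_endpoints A).

Lemma endpoints_adj (G : sgraph) (A : edge G) :
  adj (endpoints A).1 (endpoints A).2.
Proof. by case/andP: (xchooseP (edge_endpoints A)). Qed.

Lemma endpointsE (G : sgraph) (A : edge G) :
  val A = [set (endpoints A).1; (endpoints A).2].
Proof. by case/andP: (xchooseP (edge_endpoints A)) => _ /eqP. Qed.

Lemma endpoint1_in (G : sgraph) (A : edge G) : (endpoints A).1 \in val A.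
Proof. by rewrite endpointsE set21. Qed.

Lemma endpoint2_in (G : sgraph) (A : edge G) : (endpoints A).2 \in val A.
Proof. by rewrite endpointsE set22. Qed.

Lemma meet_closed_nbh (G : sgraph) (A C : line_graph G) (x : G) :
  x \in val A -> x \in val C -> C \in closed_nbh A.
Proof.
move=> xA xC; rewrite !inE; case: (eqVneq C A) => //= neqCA.
by rewrite /line_adj eq_sym neqCA; apply/set0Pn; exists x; rewrite inE xA.
Qed.

(** If [A] and [B] differed, some edge through both [x] and [y] would lie in both closed
    neighbourhoods. Every later use of the packing hypothesis passes through this criterion. *)
Lemma two_packing_eq (G : sgraph) (X : {set line_graph G})
    (A B : line_graph G) (x y : G) :
  two_packing X -> A \in X -> B \in X -> x \in val A -> y \in val B ->
  (x == y) || adj x y -> A = B.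
Proof.
move=> /forall_inP packX AX BX xA yB xy.
have {packX} /implyP := forall_inP (packX A AX) B BX.
case: (eqVneq A B) => // _ /(_ isT) dAB.
(* The common neighbour [C] is [B] itself when [x = y], and the edge [xy] otherwise. *)
suff [C CA CB] : exists2 C : line_graph G, x \in val C & y \in val C.
  by have := disjointFr dAB (meet_closed_nbh xA CA); rewrite (meet_closed_nbh yB CB).
case/orP: xy => [/eqP-> | adjxy]; first by exists B.
have Cedge : [set x; y] \in edges G by apply/imsetP; exists (x, y); rewrite ?inE.
by exists (exist _ [set x; y] Cedge : edge G); rewrite ?set21 ?set22.
Qed.

Lemma two_packing_super_dominating (G : sgraph) (X : {set line_graph G}) :
  two_packing X ->
  super_dominating (~: [set (endpoints A).1 | A : edge G in X]).
Proof.
move=> packX; apply/forall_inP => u; rewrite setCK => /imsetP[A AX ->].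
apply/exists_inP; exists (endpoints A).2.
  (* The second endpoint of [A] survives: were it the first endpoint of some [B] in [X], then
     [A = B] and [A] would be a loop. *)
  rewrite inE; apply/imsetP => -[B BX eqAB].
  have defA : A = B.
    by apply: (two_packing_eq packX AX BX (endpoint2_in A) (endpoint1_in B));
      rewrite eqAB eqxx.
  by have := endpoints_adj A; rewrite eqAB defA adj_irr.
apply/eqP/setP => w; rewrite !inE; apply/andP/eqP => [[adjw /imsetP[B BX defw]] | ->].
  rewrite defw in adjw *.
  by rewrite (two_packing_eq packX AX BX (endpoint2_in A) (endpoint1_in B)) ?adjw ?orbT.
by rewrite adj_sym endpoints_adj; split=> //; apply: imset_f.
Qed.

Lemma super_domination_two_packing (G : sgraph) (X : {set line_graph G}) :
  two_packing X -> super_domination_number G + #|X| <= #|G|.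
Proof.
move=> packX; pose R := [set (endpoints A).1 | A : edge G in X].
(* Edges of [X] sharing a first endpoint coincide, so one vertex is deleted per edge. *)
have cardR : #|R| = #|X|.
  apply: card_in_imset => A B AX BX eqAB.
  by apply: (two_packing_eq packX AX BX (endpoint1_in A) (endpoint1_in B));
    rewrite eqAB eqxx.
rewrite -cardR -(cardsC R) addnC leq_add2l.
by apply: (super_domination_number_min G).2; apply: two_packing_super_dominating.
Qed.

Theorem theorem17 (G : sgraph) (n : nat) (order_G : #|G| = n) :
  ((super_domination_number G)%:Z <= n%:Z - (packing_number (line_graph G))%:Z)%R.
Proof.
rewrite Num.Theory.lerBrDr -PoszD lez_nat -order_G.
(* Isolating the packing number, so that the maximum can be bounded set by set, uses truncated
   subtraction, which is faithful only under this bound. *)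
have gammaG : super_domination_number G <= #|G|.
  by rewrite -cardsT; apply: (super_domination_number_min G).2; apply: super_dominatingT.
rewrite -leq_subRL //; apply/bigmax_leqP => X packX.
by rewrite leq_subRL // super_domination_two_packing.
Qed.
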